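(* Let $G$ be a graph with $n$ vertices that is not 2-paintable. Then: (a) $M(G)\le 2n-3$; (b) $M(G)=2n-3$ if and only if $G$ contains the triangle $C_3$ as a subgraph.
   Context: All graphs are finite and simple. Let $f:V(G)\to\mathbb{Z}_{\ge 0}$. The game $(G,f)$ is played by Lister and Painter. In round $i$ Lister chooses, adaptively, a nonempty set $V_i\subseteq V(G)$ of marked vertices, and then Painter, seeing $V_1,\dots,V_i$, chooses an independent set $X_i\subseteq V_i$ whose vertices receive color $i$. A vertex that has been colored needs no further coloring, but may still be marked later. Painter wins if at the end every vertex has been colored. In the game with exactly $t$ rounds ($t$ is known to both players in advance), Lister must choose $V_1,\dots,V_t$ so that each vertex $v$ lies in exactly $f(v)$ of them; $G$ is $[f,t]$-paintable if Painter has a winning strategy in this game (vacuously true if no legal sequence of marked sets of length $t$ exists). In the unrestricted game the number of rounds is not fixed in advance and play continues until every vertex $v$ has been marked $f(v)$ times (never more); $G$ is $f$-paintable if Painter has a winning strategy in the unrestricted game. For the constant function $f\equiv k$ we say $k$-paintable and $[k,t]$-paintable. $M(G)$ is the maximum $t$ such that $G$ is not $[2,t]$-paintable. *)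

(* Defs.v *)
From mathcomp Require Import boolp classical_sets.
From mathcomp Require Import all_boot.

Set Implicit Arguments.
Unset Strict Implicit.
Unset Printing Implicit Defensive.

(* A finite simple graph is a symmetric irreflexive relation [e] on a finite
   type [T]; the Lister's play is the sequence [Vs] of marked sets, so round i
   (counted from 1) marks [nth set0 Vs i.-1]. *)

Definition independent (T : finType) (e : rel T) (X : {set T}) : bool :=
  [forall x in X, forall y in X, ~~ e x y].

Definition legal_play (T : finType) (f : T -> nat) (Vs : seq {set T}) : Prop :=
  (forall V, V \in Vs -> V != set0) /\
  (forall v, count (fun V : {set T} => v \in V) Vs = f v).

(* A Painter strategy answers the history [:: V_1; ...; V_i] of marked sets with
   X_i.  Painter's own earlier moves are determined by that history, and a
   strategy that beats every fixed play beats every adaptive Lister. *)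
Definition strategy (T : finType) : Type := seq {set T} -> {set T}.

Definition response (T : finType) (S : strategy T) (Vs : seq {set T})
    (i : nat) : {set T} := S (take i.+1 Vs).

Definition beats (T : finType) (e : rel T) (S : strategy T)
    (Vs : seq {set T}) : Prop :=
  (forall i, i < size Vs ->
     response S Vs i \subset nth set0 Vs i /\ independent e (response S Vs i)) /\
  (forall v, exists2 i, i < size Vs & v \in response S Vs i).

(* One strategy has to handle plays of all lengths: Painter does not know the
   number of rounds. *)
Definition paintable (T : finType) (e : rel T) (f : T -> nat) : Prop :=
  exists S : strategy T, forall Vs, legal_play f Vs -> beats e S Vs.

(* The strategy may depend on the announced number [t] of rounds. *)
Definition paintable_in (T : finType) (e : rel T) (f : T -> nat)
    (t : nat) : Prop :=
  exists S : strategy T,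
    forall Vs, size Vs = t -> legal_play f Vs -> beats e S Vs.

(* The largest t such that the graph is not [2,t]-paintable (0 if there is no
   such t; the set is bounded, as no legal play is longer than 2 * #|T|). *)
Definition M (T : finType) (e : rel T) : nat :=
  xget 0 [set t : nat | ~ paintable_in e (fun=> 2) t /\
    forall s, ~ paintable_in e (fun=> 2) s -> s <= t]%classic.

(* The three vertices are distinct when [e] is irreflexive. *)
Definition contains_C3 (T : finType) (e : rel T) : Prop :=
  exists x y z : T, [/\ e x y, e y z & e z x].

(* Main.v *)
Require Import Defs.
From mathcomp Require Import boolp classical_sets.
From mathcomp Require Import all_boot.
From mathcomp Require Import zify.

Set Implicit Arguments.
Unset Strict Implicit.
Unset Printing Implicit Defensive.

(** Call the sum of [#|V_i| - 1] over the rounds the excess of a play.  When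
    every vertex is marked twice the excess is [2n - t], so announcing [t]
    rounds amounts to giving Lister a budget: a round that marks [m] vertices
    costs [m - 1], and [t >= 2n - 3] means a budget of at most 3.

    With a budget this small the only danger comes from the set [A] of critical
    vertices, those not yet coloured that have a single mark left.  Painter
    wins if the pair (remaining budget [k], [A]) stays safe, where safe means
    - [k = 0]: anything (only singletons are left, and Painter colours them);
    - [k = 1]: [A] is independent (one pair is left, which Painter must be able
      to colour if both its vertices are critical);
    - [k = 2]: [A] has at most one vertex, and is empty unless the graph is
      triangle-free (marking an edge that forms a triangle with the critical
      vertex would leave two adjacent critical vertices and budget 1);
    - [k = 3]: [A] is empty and the graph is triangle-free (marking a triangle
      would lead to the same losing position).
    A short case analysis ([safe_step]) shows that Painter can always answer so
    as to remain safe.  At the start [A] is empty, so Painter wins on every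
    graph when [t >= 2n - 2], and on every triangle-free graph when
    [t >= 2n - 3] ([paintable_in_of_excess]).

    Conversely, on a triangle [x y z] Lister spends a budget of exactly 3,
    marking [x, y, z], then two of these that were left uncoloured, then only
    singletons ([C3_not_paintable_in]).  As these two are adjacent, the
    second round cannot colour both, and neither is marked again.  Hence
    [2n - 3] rounds defeat Painter exactly when there is a triangle.  A graph
    that is not 2-paintable has at least two vertices, so [2n - 3] is positive
    and cannot be confused with the default value 0 of [M]. *)

(** * Strategies from invariants *)

(** Painter's moves are answers to histories, so the set coloured so far has to
    be recomputed by replaying the history; this lemma does so once and for
    all.  An answer is needed only at histories that some play of [P]
    extends, since on the others Painter may move arbitrarily. *)
Lemma strategy_of_invariant (T : finType) (e : rel T)
    (P : seq {set T} -> Prop) (Inv : seq {set T} -> {set T} -> Prop) :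
    Inv [::] set0 ->
    (forall h V C r, P (rcons h V ++ r) -> Inv h C ->
       exists X : {set T}, [/\ X \subset V, independent e X &
                               Inv (rcons h V) (C :|: X)]) ->
    (forall Vs C, P Vs -> Inv Vs C -> C = setT) ->
  exists S : strategy T, forall Vs, P Vs -> beats e S Vs.
Proof.
move=> Inv0 InvS InvE.
pose good (a : seq {set T} * {set T} * {set T}) (X : {set T}) :=
  let: (h, C, V) := a in (exists r, P (rcons h V ++ r)) -> Inv h C ->
  [/\ X \subset V, independent e X & Inv (rcons h V) (C :|: X)].
have [ans ansP] : {ans & forall a, good a (ans a)}.
  apply: choice => -[[h C] V].
  have [[r Pr]|noP] := pselect (exists r, P (rcons h V ++ r)); last by exists set0.
  have [IhC|noI] := pselect (Inv h C); last by exists set0.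
  by have [X HX] := InvS _ _ _ _ Pr IhC; exists X.
(* A state pairs the history with the set coloured so far. *)
pose step (s : seq {set T} * {set T}) V := (rcons s.1 V, s.2 :|: ans (s, V)).
pose state h := foldl step ([::], set0) h.
have stateS h V : state (rcons h V) = step (state h) V by rewrite /state foldl_rcons.
have state1 h : (state h).1 = h.
  by elim/last_ind: h => // h V IH; rewrite stateS /= IH.
(* The move made at the end of a history [h] is the answer in the state reached
   just before its last round. *)
pose S (h : seq {set T}) := ans (state (take (size h).-1 h), nth set0 h (size h).-1).
exists S => Vs PVs.
have resp i : i < size Vs ->
    response S Vs i = ans (state (take i Vs), nth set0 Vs i).
  move=> lti; rewrite /response /S size_takel //= nth_take //.
  by rewrite take_takel.
have inv i : i <= size Vs -> Inv (take i Vs) (state (take i Vs)).2 /\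
   (forall j, j < i -> response S Vs j \subset nth set0 Vs j /\
                       independent e (response S Vs j)) /\
   (forall v, v \in (state (take i Vs)).2 ->
              exists2 j, j < i & v \in response S Vs j).
  elim: i => [|i IH] lti.
    by rewrite take0 /=; split; [|split=> // v; rewrite inE].
  have [Ii [legi coli]] := IH (ltnW lti).
  have := ansP (state (take i Vs), nth set0 Vs i).
  rewrite -(resp i lti) /good.
  case Est: (state (take i Vs)) => [h C]; have := state1 (take i Vs).
  rewrite Est /= => ->; rewrite -take_nth //.
  rewrite Est /= in Ii coli.
  have ex : exists r, P (take i.+1 Vs ++ r).
    by exists (drop i.+1 Vs); rewrite cat_take_drop.
  move=> /(_ ex Ii) [sub ind II].
  have E2 : (state (take i.+1 Vs)).2 = C :|: response S Vs i.
    by rewrite (take_nth set0) // stateS /step /= (resp i lti) Est.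
  rewrite E2; split=> //; split.
    move=> j; rewrite ltnS leq_eqVlt => /orP[/eqP->//|]; exact: legi.
  move=> v; rewrite inE => /orP[/coli [j lj vj]|vi]; last by exists i.
  by exists j => //; apply: ltnW.
have [If [legf colf]] := inv _ (leqnn _).
split; first exact: legf.
by rewrite take_size in If colf => v; apply: colf; rewrite (InvE _ _ PVs If) inE.
Qed.

(** * Painter against a small excess *)

Lemma independentP (T : finType) (e : rel T) (X : {set T}) :
  reflect {in X &, forall x y, ~~ e x y} (independent e X).
Proof.
apply: (iffP forall_inP) => H x => [y xX yX|xX].
  by move/forall_inP: (H x xX); apply.
by apply/forall_inP => y; apply: H.
Qed.

Lemma independentS (T : finType) (e : rel T) (X Y : {set T}) :
  X \subset Y -> independent e Y -> independent e X.
Proof.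
move=> /subsetP XY /independentP iY; apply/independentP => x y xX yX.
by apply: iY; apply: XY.
Qed.

Lemma independent1 (T : finType) (e : rel T) (x : T) :
  irreflexive e -> independent e [set x].
Proof.
move=> irr; apply/independentP => y z.
by rewrite !inE => /eqP-> /eqP->; rewrite irr.
Qed.

Lemma independent_card1 (T : finType) (e : rel T) (X : {set T}) :
  irreflexive e -> #|X| <= 1 -> independent e X.
Proof.
move=> irr /card_le1_eqP X1; apply/independentP => x y xX yX.
by rewrite (X1 x y) // irr.
Qed.

Lemma independent2 (T : finType) (e : rel T) (x y : T) :
  symmetric e -> irreflexive e -> ~~ e x y -> independent e [set x; y].
Proof.
move=> sym irr nxy; apply/independentP => u v.
by rewrite !inE => /orP[]/eqP-> /orP[]/eqP->; rewrite ?irr // sym.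
Qed.

Definition safe (T : finType) (e : rel T) (k : nat) (A : {set T}) : Prop :=
  match k with
  | 0 => True
  | 1 => independent e A
  | 2 => #|A| <= 1 /\ (A = set0 \/ ~ contains_C3 e)
  | 3 => A = set0 /\ ~ contains_C3 e
  | _ => False
  end.

Lemma safe_indep (T : finType) (e : rel T) k (A : {set T}) :
  irreflexive e -> 0 < k -> safe e k A -> independent e A.
Proof.
move=> irr; case: k => [|[|[|[|k]]]] //= _ => [[c _]|[-> _]].
  exact: independent_card1.
by apply: independent_card1; rewrite ?cards0.
Qed.

Lemma safeS (T : finType) (e : rel T) k (A B : {set T}) :
  A \subset B -> safe e k B -> safe e k A.
Proof.
move=> AB; case: k => [|[|[|[|k]]]] //=.
- exact: independentS.
- move=> [c d]; split; first exact: leq_trans (subset_leq_card AB) c.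
  by case: d => [B0|]; [left; apply/eqP; rewrite -subset0 -B0 | right].
by move=> [B0 ?]; split=> //; apply/eqP; rewrite -subset0 -B0.
Qed.

(** A smaller remaining budget only helps Painter, so wasted marks, on vertices
    already coloured, can be ignored. *)
Lemma safe_le (T : finType) (e : rel T) j k (A : {set T}) :
  irreflexive e -> j <= k -> safe e k A -> safe e j A.
Proof.
move=> irr lejk sk; case: j lejk => [//|[|[|[|j]]]] lejk.
- exact: safe_indep lejk sk.
- case: k lejk sk => [|[|[|[|k]]]] //= _ [-> ?]; rewrite cards0.
  by split=> //; left.
- by case: k lejk sk => [|[|[|[|k]]]].
- by case: k lejk sk => [|[|[|[|k]]]].
Qed.

(** Here [A] is the critical set and [W] the set of uncoloured marked vertices.
    Answering [X] makes [(A :|: W) :\: X] critical, provided that [X] contains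
    the vertices of [W] receiving their last mark. *)
Lemma safe_step (T : finType) (e : rel T) k (A W : {set T}) :
  symmetric e -> irreflexive e -> safe e k A -> #|W|.-1 <= k ->
  exists X : {set T}, [/\ X \subset W, A :&: W \subset X, independent e X &
                safe e (k - #|W|.-1) ((A :|: W) :\: X)].
Proof.
move=> sym irr sA leWk.
have [W1|W2] := leqP #|W| 1.
  exists W; split; rewrite ?subsetIr //; first exact: independent_card1.
  have -> : #|W|.-1 = 0 by lia.
  by rewrite subn0 setDUl setDv setU0; apply: safeS sA; apply: subsetDl.
have indA : independent e A by apply: safe_indep sA => //; lia.
(* If the budget is exhausted, it is enough to colour the critical vertices. *)
have [k0|kpos] := posnP (k - #|W|.-1).
  exists (A :&: W); rewrite k0; split=> //; first exact: subsetIr.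
  by apply: independentS indA; apply: subsetIl.
have [[k3 W2']|[[k3 W3]|[k2 W2']]] :
  (k = 3 /\ #|W| = 2) \/ (k = 3 /\ #|W| = 3) \/ (k = 2 /\ #|W| = 2).
- have : k <= 3 by case: k sA {leWk kpos} => [|[|[|[|k]]]].
  lia.
- move: sA; rewrite k3 W2' /= => -[-> tf].
  have /cards2P [b [c [nbc ->]]] : #|W| == 2 by rewrite W2'.
  exists [set b]; split.
  + by rewrite sub1set !inE eqxx.
  + by rewrite set0I sub0set.
  + exact: independent1.
  split; last by right.
  rewrite set0U; apply: leq_trans (_ : #|[set c]| <= _); last by rewrite cards1.
  by apply: subset_leq_card; apply/subsetP => z; rewrite !inE; case: eqVneq.
- move: sA; rewrite k3 W3 /= => -[-> tf].
  have [a aW] : exists a, a \in W by apply/card_gt0P; rewrite W3.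
  have /cards2P [b [c [nbc Wbc]]] : #|W :\ a| == 2.
    by move: W3; rewrite (cardsD1 a) aW add1n => -[->].
  have WE : W = a |: [set b; c] by rewrite -Wbc setD1K.
  (* Painter colours one vertex and leaves a nonadjacent pair. *)
  have [x [y [z [WE' nyz]]]] : exists x y z, W = x |: [set y; z] /\ ~~ e y z.
    case ebc: (e b c); last by exists a, b, c; rewrite ebc.
    case eab: (e a b); last first.
      by exists c, a, b; rewrite eab WE [in RHS]setUC setUA.
    case eca: (e c a); first by case: tf; exists a, b, c.
    by exists b, c, a; rewrite eca WE setUC -setUA.
  exists [set x]; split.
  + by rewrite sub1set WE' !inE eqxx.
  + by rewrite set0I sub0set.
  + exact: independent1.
  rewrite set0U; apply: independentS (independent2 sym irr nyz).
  by apply/subsetP => u; rewrite WE' !inE; case: (u == x).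
move: sA; rewrite k2 W2' /= => -[A1 tf].
have /cards2P [b [c [nbc WE]]] : #|W| == 2 by rewrite W2'.
have [A0|[a aA]] := set_0Vmem A.
  exists [set b]; rewrite A0 set0I set0U; split; rewrite ?sub0set //.
  + by rewrite sub1set WE !inE eqxx.
  + exact: independent1.
  apply: independentS (independent1 c irr).
  by apply/subsetP => u; rewrite WE !inE; case: (u == b).
have AE : A = [set a] by apply/eqP; rewrite eq_sym eqEcard sub1set aA cards1.
have {}tf : ~ contains_C3 e by case: tf => // A0; move: aA; rewrite A0 inE.
have [aW|aW] := boolP (a \in W).
  exists [set a]; rewrite AE; split.
  + by rewrite sub1set.
  + exact: subsetIl.
  + exact: independent1.
  apply: independent_card1 => //.
  have -> : ([set a] :|: W) :\: [set a] = W :\ a.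
    by apply/setP => u; rewrite !inE; case: (u == a).
  by move: W2'; rewrite (cardsD1 a) aW add1n => -[->].
have -> : A :&: W = set0.
  by apply/setP => u; rewrite AE !inE; case: eqP => //= ->; apply/negbTE.
(* Painter colours both marked vertices if they are not adjacent; otherwise
   the critical vertex is not adjacent to both, and Painter leaves uncoloured a
   nonneighbour of it. *)
case ebc: (e b c); last first.
  exists W; split; rewrite ?sub0set //.
    by rewrite WE; apply: independent2; rewrite ?ebc.
  rewrite setDUl setDv setU0 AE.
  by apply: independentS (subsetDl _ _) _; apply: independent1.
have [x [y [WE' nay]]] : exists x y, W = [set x; y] /\ ~~ e a y.
  case eab: (e a b); last by exists c, b; rewrite eab setUC.
  case eca: (e c a); first by case: tf; exists a, b, c.
  by exists b, c; rewrite sym eca.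
exists [set x]; split; rewrite ?sub0set //.
- by rewrite sub1set WE' !inE eqxx.
- exact: independent1.
apply: independentS (independent2 sym irr nay).
by apply/subsetP => u; rewrite AE WE' !inE; case: (u == x); rewrite ?orbF.
Qed.

Definition marks (T : finType) (h : seq {set T}) (v : T) : nat :=
  count (fun V : {set T} => v \in V) h.

Definition excess (T : finType) (h : seq {set T}) : nat :=
  \sum_(V <- h) #|V|.-1.

Lemma marks_rcons (T : finType) (h : seq {set T}) V v :
  marks (rcons h V) v = marks h v + (v \in V).
Proof. by rewrite /marks -cats1 count_cat /= addn0. Qed.

Lemma excess_rcons (T : finType) (h : seq {set T}) V :
  excess (rcons h V) = excess h + #|V|.-1.
Proof. by rewrite /excess big_rcons. Qed.

Lemma excess_cat (T : finType) (h r : seq {set T}) :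
  excess (h ++ r) = excess h + excess r.
Proof. by rewrite /excess big_cat. Qed.

(** Double counting of the marks. *)
Lemma excess_size (T : finType) (Vs : seq {set T}) :
  legal_play (fun=> 2) Vs -> excess Vs + size Vs = 2 * #|T|.
Proof.
move=> [ne two].
have <- : \sum_(V <- Vs) #|V| = 2 * #|T|.
  rewrite mulnC -sum_nat_const.
  under [RHS]eq_bigr => v _ do rewrite -(two v) -sum1_count.
  rewrite (exchange_big_dep predT) //=; apply: eq_bigr => V _.
  by rewrite sum1dep_card cardsE.
rewrite /excess -sum1_size -big_split /= !big_seq.
apply: eq_bigr => V /ne; rewrite -card_gt0; lia.
Qed.

(** Painter maintains that no uncoloured vertex has been marked twice and that
    the remaining budget [k - excess h] and the critical set are safe. *)
Lemma paintable_in_of_excess (T : finType) (e : rel T) k t :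
  symmetric e -> irreflexive e -> safe e k set0 -> 2 * #|T| <= t + k ->
  paintable_in e (fun=> 2) t.
Proof.
move=> sym irr s0 tk.
pose crit h (C : {set T}) := [set v | (v \notin C) && (marks h v == 1)].
pose Inv h (C : {set T}) :=
  (forall v, v \notin C -> marks h v <= 1) /\ safe e (k - excess h) (crit h C).
pose P (Vs : seq {set T}) := size Vs = t /\ legal_play (fun=> 2) Vs.
suff [S HS] : exists S : strategy T, forall Vs, P Vs -> beats e S Vs.
  by exists S => Vs sz leg; apply: HS.
apply: (@strategy_of_invariant _ _ _ Inv).
- split=> //; rewrite /excess big_nil subn0.
  by have -> : crit [::] set0 = set0 by apply/setP => v; rewrite !inE.
- move=> h V C r [sz leg] [low saf].
  have exV : excess h + #|V|.-1 <= k.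
    have := excess_size leg; rewrite sz excess_cat excess_rcons; lia.
  pose W := V :\: C.
  have WV : #|W| <= #|V| by apply: subset_leq_card; apply: subsetDl.
  have leW : #|W|.-1 <= k - excess h by lia.
  have [X [XW AX iX sX]] := safe_step sym irr saf leW.
  exists X; split=> //; first exact: subset_trans XW (subsetDl _ _).
  have last_mark v : v \in V -> v \notin C -> v \notin X -> marks h v = 0.
    move=> vV vC vX; apply/eqP; move: (low v vC).
    case E: (marks h v) => [//|[|m]] // _.
    by move/subsetP: AX => /(_ v); rewrite !inE vC vV E /= (negbTE vX) => /(_ isT).
  split.
    move=> v; rewrite inE negb_or => /andP[vC vX]; rewrite marks_rcons.
    have [vV|_] := boolP (v \in V); first by rewrite last_mark.
    by rewrite addn0 low.
  rewrite excess_rcons.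
  apply: (@safe_le _ _ _ (k - excess h - #|W|.-1)) => //; first by lia.
  apply: safeS sX; apply/subsetP => v; rewrite !inE marks_rcons negb_or.
  move=> /andP[/andP[vC vX]]; rewrite vC vX /=.
  by case: (v \in V); rewrite ?orbT // addn0 orbF.
move=> Vs C [sz [_ two]] [low _]; apply/setP => v; rewrite inE.
by apply/negPn/negP => /low; rewrite /marks two.
Qed.

(** Every vertex is marked at least once, and colouring the whole marked set is
    allowed when there are no edges. *)
Lemma edgeless_paintable (T : finType) (e : rel T) :
  (forall x y, ~~ e x y) -> paintable e (fun=> 2).
Proof.
move=> e0; exists (fun h => last set0 h) => Vs [_ two].
have resp i : i < size Vs -> response (fun h => last set0 h) Vs i = nth set0 Vs i.
  by move=> lti; rewrite /response (take_nth set0) // last_rcons.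
split=> [i lti|v].
  by rewrite resp //; split=> //; apply/independentP => x y _ _; apply: e0.
have : has (fun V : {set T} => v \in V) Vs by rewrite has_count two.
move=> /(has_nthP set0) [i lti vi]; exists i => //.
by rewrite resp.
Qed.

(** * Lister on a triangle *)

(** The complement of the triangle is listed twice because its vertices, each
    alone in its rounds, still need both of their marks. *)
Definition C3_play (T : finType) (x y z : T) : seq {set T} :=
  let R := [seq [set v] | v <- enum (~: [set x; y; z])] in
  [:: [set x; y; z], [set y; z], [set x] & R ++ R].

Lemma C3_play_marks (T : finType) (x y z v : T) :
  x != y -> z != x -> marks (C3_play x y z) v = 2.
Proof.
move=> nxy nzx; rewrite /marks /C3_play /=.
set Q := [set x; y; z]; set R := map _ _.
have marksR : count (fun V : {set T} => v \in V) R = (v \notin Q).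
  rewrite count_map (eq_count (a2 := pred1 v)).
    by rewrite count_uniq_mem ?enum_uniq // mem_enum inE.
  by move=> u; rewrite /= inE eq_sym.
rewrite count_cat marksR !inE.
have [->|nx] := eqVneq v x; first by rewrite (negbTE nxy) eq_sym (negbTE nzx).
by have [->|ny] := eqVneq v y; rewrite ?orbT //; case: (v == z).
Qed.

Lemma C3_play_size (T : finType) (x y z : T) :
  x != y -> y != z -> z != x -> size (C3_play x y z) = 2 * #|T| - 3.
Proof.
move=> nxy nyz nzx; rewrite /= size_cat size_map -cardE cardsCs setCK.
have cQ : #|[set x; y; z]| = 3.
  by rewrite setUC cardsU1 cards2 !inE negb_or nxy nzx eq_sym nyz.
have : #|[set x; y; z]| <= #|T| by apply: max_card.
rewrite cQ; move: #|T| => m; lia.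
Qed.

Lemma C3_play_legal (T : finType) (x y z : T) :
  x != y -> z != x -> legal_play (fun=> 2) (C3_play x y z).
Proof.
move=> nxy nzx; split=> [V|v]; last exact: C3_play_marks.
rewrite !inE mem_cat orbb => /or4P[/eqP->|/eqP->|/eqP->|/mapP[u _ ->]];
  apply/set0Pn; [exists x|exists y|exists x|exists u]; by rewrite !inE eqxx.
Qed.

(** [y] and [z] are marked in the first two rounds only, and since they are
    adjacent the second round colours at most one of them. *)
Lemma C3_play_beaten (T : finType) (e : rel T) (S : strategy T) (x y z : T) :
    x != y -> z != x -> e y z -> beats e S (C3_play x y z) ->
  independent e (S [:: [set x; y; z]]) /\
  (y \in S [:: [set x; y; z]]) || (z \in S [:: [set x; y; z]]).
Proof.
move=> nxy nzx eyz [leg col].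
split; first by have [] := leg 0 isT.
apply: contraT; rewrite negb_or => /andP[yS zS].
have second u : u \in [set y; z] -> u \notin S [:: [set x; y; z]] ->
    u \in response S (C3_play x y z) 1.
  move=> uyz uS; have [[|[|i]] lti ui] := col u => //.
    by rewrite /response /= in ui; rewrite ui in uS.
  have [/subsetP/(_ u ui) uin _] := leg _ lti.
  have uQ : u \in [set x; y; z].
    by move: uyz; rewrite !inE -orbA => ->; rewrite orbT.
  have c0 : count (fun V : {set T} => u \in V) (drop 2 (C3_play x y z)) = 0.
    have := C3_play_marks u nxy nzx; rewrite /marks.
    rewrite -{1}(cat_take_drop 2 (C3_play x y z)) count_cat.
    by rewrite [count _ (take _ _)]/= uQ uyz => -[].
  suff : has (fun V : {set T} => u \in V) (drop 2 (C3_play x y z)).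
    by rewrite has_count c0.
  apply/hasP; exists (nth set0 (C3_play x y z) i.+2) => //.
  by rewrite -[i.+2]/(2 + i) -nth_drop; apply: mem_nth.
have [//|_ /independentP ind] := leg 1.
have := ind y z; rewrite eyz; apply; apply: second => //.
all: by rewrite !inE eqxx ?orbT.
Qed.

(** By rotating the triangle, every two of its vertices must contain one
    coloured in the first round, so two adjacent vertices were. *)
Lemma C3_not_paintable_in (T : finType) (e : rel T) :
  irreflexive e -> contains_C3 e -> ~ paintable_in e (fun=> 2) (2 * #|T| - 3).
Proof.
move=> irr [x [y [z [exy eyz ezx]]]] [S HS].
have neq u v : e u v -> u != v by case: eqVneq => // ->; rewrite irr.
have [nxy nyz nzx] := And3 (neq _ _ exy) (neq _ _ eyz) (neq _ _ ezx).
have win a b c : e a b -> e b c -> e c a ->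
    independent e (S [:: [set a; b; c]]) /\
    (b \in S [:: [set a; b; c]]) || (c \in S [:: [set a; b; c]]).
  move=> /neq nab ebc /neq nca; have nbc := neq _ _ ebc.
  apply: C3_play_beaten => //.
  by apply: HS; [apply: C3_play_size|apply: C3_play_legal].
have rot a b c : [set b; c; a] = [set a; b; c] :> {set T}.
  by rewrite [LHS]setUC setUA.
have [/independentP ind yz] := win _ _ _ exy eyz ezx.
have [_ zx] := win _ _ _ eyz ezx exy.
have [_ xy] := win _ _ _ ezx exy eyz.
rewrite (rot x y z) in zx; rewrite (rot y z x) (rot x y z) in xy.
have [xS|nx] := boolP (x \in S [:: [set x; y; z]]); last first.
  rewrite (negbTE nx) orbF in zx; rewrite (negbTE nx) /= in xy.
  by have := ind _ _ xy zx; rewrite eyz.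
have [yS|ny] := boolP (y \in S [:: [set x; y; z]]).
  by have := ind _ _ xS yS; rewrite exy.
rewrite (negbTE ny) /= in yz.
by have := ind _ _ yz xS; rewrite ezx.
Qed.

(** * The value of [M] *)

Lemma M_le (T : finType) (e : rel T) m :
  (forall t, m < t -> paintable_in e (fun=> 2) t) -> M e <= m.
Proof.
move=> Pm; rewrite /M; case: xgetP => [t _ [nPt _]|_ //].
by rewrite leqNgt; apply/negP => /Pm.
Qed.

Lemma M_eq (T : finType) (e : rel T) m :
  ~ paintable_in e (fun=> 2) m ->
  (forall t, m < t -> paintable_in e (fun=> 2) t) -> M e = m.
Proof.
move=> nPm Pm.
have leM t : ~ paintable_in e (fun=> 2) t -> t <= m.
  by move=> nPt; rewrite leqNgt; apply/negP => /Pm.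
apply: xget_unique; first by split.
by move=> t [nPt maxt]; apply/eqP; rewrite eqn_leq leM // maxt.
Qed.

Theorem theorem24 (T : finType) (e : rel T)
    (e_sym : symmetric e) (e_irr : irreflexive e)
    (n : nat) (card_T : #|T| = n)
    (not2 : ~ paintable e (fun=> 2)) :
  M e <= 2 * n - 3 /\ (M e = 2 * n - 3 <-> contains_C3 e).
Proof.
have n2 : 2 <= n.
  rewrite -card_T ltnNge; apply/negP => /fintype_le1P T1; apply: not2.
  by apply: edgeless_paintable => x y; rewrite (T1 x y) e_irr.
have large t : 2 * n - 3 < t -> paintable_in e (fun=> 2) t.
  move=> lt; apply: (@paintable_in_of_excess _ _ 2) => //=.
    by rewrite cards0; split=> //; left.
  rewrite card_T; lia.
split; first exact: M_le.
split=> [EM|tri].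
  apply: contrapT => tf; suff : M e <= 2 * n - 4 by lia.
  apply: M_le => t lt; apply: (@paintable_in_of_excess _ _ 3) => //.
  rewrite card_T; lia.
by apply: M_eq => //; rewrite -card_T; apply: C3_not_paintable_in.
Qed.
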